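(* Let $n\in\mathbb{N}$. Given a $\mathrm{Cu}$-semigroup $S$ satisfying $\dim(S)\leq n$, the countably based sub-$\mathrm{Cu}$-semigroups $T\subseteq S$ satisfying $\dim(T)\leq n$ form a $\sigma$-complete, cofinal subset of $\mathrm{Sub}_{\mathrm{ctbl}}(S)$. In particular, the property of $\mathrm{Cu}$-semigroups of having dimension at most $n$ satisfies the L\''owenheim-Skolem condition.
   Context: Way-below relation: in a partially ordered set, $x\ll y$ means that for every increasing sequence $(z_n)_n$ that has a supremum $z$ with $y\leq z$ there exists $n$ with $x\leq z_n$. A $\mathrm{Cu}$-semigroup is an abelian monoid $S$ with a partial order such that $0\leq x$ for all $x$, and $x\leq y$ implies $x+z\leq y+z$, satisfying: (O1) every increasing sequence has a supremum; (O2) every element is the supremum of a $\ll$-increasing sequence (i.e. $x_n\ll x_{n+1}$ for all $n$); (O3) $x'\ll x$ and $y'\ll y$ imply $x'+y'\ll x+y$; (O4) $\sup_n x_n+\sup_n y_n=\sup_n(x_n+y_n)$ for increasing sequences $(x_n)_n,(y_n)_n$. A $\mathrm{Cu}$-morphism is an order-preserving monoid morphism between $\mathrm{Cu}$-semigroups that preserves suprema of increasing sequences and the way-below relation. A submonoid $T\subseteq S$ is a sub-$\mathrm{Cu}$-semigroup if $T$ is a $\mathrm{Cu}$-semigroup with respect to the order induced by $S$ and the inclusion map $T\to S$ is a $\mathrm{Cu}$-morphism. A subset $B\subseteq S$ is a basis if for all $x'\ll x$ in $S$ there exists $y\in B$ with $x'\ll y\ll x$; $S$ is countably based if it has a countable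 basis. $\mathrm{Sub}_{\mathrm{ctbl}}(S)$ is the collection of countably based sub-$\mathrm{Cu}$-semigroups of $S$. For a subset $T\subseteq S$, its sup-closure $\overline{T}^{\mathrm{sup}}$ is the smallest subset of $S$ that contains $T$ and is closed under suprema of increasing sequences. If $\mathcal{T}\subseteq\mathrm{Sub}_{\mathrm{ctbl}}(S)$ is countable and (upward) directed, then $\overline{\bigcup\mathcal{T}}^{\mathrm{sup}}\in\mathrm{Sub}_{\mathrm{ctbl}}(S)$. A collection $\mathcal{R}\subseteq\mathrm{Sub}_{\mathrm{ctbl}}(S)$ is $\sigma$-complete if $\overline{\bigcup\mathcal{T}}^{\mathrm{sup}}\in\mathcal{R}$ for every countable, directed subset $\mathcal{T}\subseteq\mathcal{R}$; it is cofinal if for every $T_0\in\mathrm{Sub}_{\mathrm{ctbl}}(S)$ there is $T\in\mathcal{R}$ with $T_0\subseteq T$. A property $\mathcal{P}$ of $\mathrm{Cu}$-semigroups satisfies the L\''owenheim-Skolem condition if for every $\mathrm{Cu}$-semigroup $S$ satisfying $\mathcal{P}$ there exists a $\sigma$-complete, cofinal subcollection $\mathcal{R}\subseteq\mathrm{Sub}_{\mathrm{ctbl}}(S)$ such that every $R\in\mathcal{R}$ satisfies $\mathcal{P}$. Dimension (with $\mathbb{N}=\{0,1,2,\ldots\}$): for a $\mathrm{Cu}$-semigroup $S$ and $n\in\mathbb{N}$, write $\dim(S)\leq n$ if, whenever $x'\ll x\ll y_1+\ldots+y_r$ in $S$, there exist $z_{j,k}\in S$ for $j=1,\ldots,r$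 and $k=0,\ldots,n$ such that (i) $z_{j,k}\ll y_j$ for all $j,k$; (ii) $x'\ll\sum_{j,k}z_{j,k}$; (iii) $\sum_{j=1}^r z_{j,k}\ll x$ for each $k=0,\ldots,n$. Then $\dim(S)$ is the smallest such $n$, and $\dim(S)=\infty$ if no such $n$ exists. *)

(* Defs.v *)
From HB Require Import structures.
From mathcomp Require Import all_boot order ssralg.
From mathcomp Require Import boolp classical_sets functions cardinality.

Set Implicit Arguments.
Unset Strict Implicit.
Unset Printing Implicit Defensive.

Import Order.TTheory GRing.Theory.

Local Open Scope classical_set_scope.
Local Open Scope ring_scope.
Local Open Scope order_scope.

Reserved Notation "x ≪ y" (at level 70, no associativity).

Section IncreasingSequences.
Context {d : Order.disp_t} {S : porderType d}.
Implicit Types (x y s : S) (z : nat -> S) (A : set S).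

Definition increasing z := {homo z : i j / (i <= j)%N >-> i <= j}.

Definition is_sup z s := supremums (range z) s.

Definition way_below x y := forall z s, increasing z -> is_sup z s ->
  y <= s -> exists n, x <= z n.

Definition sup_closed A := forall z s, increasing z -> (forall n, A (z n)) ->
  is_sup z s -> A s.

Definition sup_closure A : set S := smallest sup_closed A.

Definition basis (B : set S) := forall x' x, way_below x' x ->
  exists y, [/\ B y, way_below x' y & way_below y x].

Definition directed (C : set (set S)) := C !=set0 /\
  forall A B, C A -> C B -> exists2 D, C D & A `<=` D /\ B `<=` D.

End IncreasingSequences.

Notation "x ≪ y" := (way_below x y) : order_scope.

Definition countably_based d (S : porderType d) :=
  exists2 B : set S, countable B & basis B.

Fact cu_display : Order.disp_t. Proof. exact. Qed.

HB.mixin Record Nmodule_isPOM S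
    of GRing.Nmodule S & Order.POrder cu_display S := {
  pom_ge0 : forall x : S, (0 : S) <= x;
  pom_leD2r : forall x y z : S, x <= y -> x + z <= y + z
}.

(* Positively ordered monoids; the [choiceType] structure below [nmodType] and
   [porderType] is available on every type by classical choice. *)
#[short(type="pomType")]
HB.structure Definition POM :=
  { S of Nmodule_isPOM S & GRing.Nmodule S & Order.POrder cu_display S }.

Section CuAxioms.
Variable S : pomType.
Implicit Types (x y : S) (z w : nat -> S).

Definition axiomO1 := forall z, increasing z -> exists s, is_sup z s.

Definition axiomO2 := forall x,
  exists2 z, (forall n, z n ≪ z n.+1) & is_sup z x.

Definition axiomO3 := forall x' x y' y, x' ≪ x -> y' ≪ y ->
  x' + y' ≪ x + y.

Definition axiomO4 := forall z w s t, increasing z -> increasing w ->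
  is_sup z s -> is_sup w t -> is_sup (fun n => z n + w n) (s + t).

Record cu_axioms : Prop := CuAxioms {
  cu_O1 : axiomO1;
  cu_O2 : axiomO2;
  cu_O3 : axiomO3;
  cu_O4 : axiomO4
}.

End CuAxioms.

HB.mixin Record POM_isCu S of POM S := { cuP : cu_axioms S }.

#[short(type="cuType")]
HB.structure Definition Cu := { S of POM_isCu S & POM S }.

Record cu_morphism (S T : pomType) (f : S -> T) : Prop := CuMorphism {
  cu_morph_le : {homo f : x y / x <= y};
  cu_morph_nmod : GRing.nmod_morphism f;
  cu_morph_sup : forall z s, increasing z -> is_sup z s -> is_sup (f \o z) (f s);
  cu_morph_way_below : forall x y, x ≪ y -> f x ≪ f y
}.

Definition submonoid (S : nmodType) (T : set S) := GRing.nmod_closed [in T].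

(* The carrier of a submonoid, with the operations and the order of [S]. *)
Definition sub_pom (S : pomType) (T : set S) (_ : submonoid T) : Type :=
  {x : S | x \in T}.

Section SubPOM.
Variables (S : pomType) (T : set S) (hT : submonoid T).
Local Notation sub := (sub_pom hT).

HB.instance Definition _ := SubChoice.on sub.
HB.instance Definition _ :=
  GRing.SubChoice_isSubNmodule.Build S [in T] sub hT.
HB.instance Definition _ :=
  Order.SubChoice_isSubPOrder.Build cu_display S [in T] cu_display sub.

Fact sub_pom_ge0 (x : sub) : (0 : sub) <= x.
Proof. by rewrite -Order.le_val GRing.val0 pom_ge0. Qed.

Fact sub_pom_leD2r (x y z : sub) : x <= y -> x + z <= y + z.
Proof. by rewrite -!Order.le_val !GRing.valD; exact: pom_leD2r. Qed.

HB.instance Definition _ := Nmodule_isPOM.Build sub sub_pom_ge0 sub_pom_leD2r.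

End SubPOM.

Record is_subcu (S : cuType) (T : set S) : Prop := IsSubCu {
  subcu_submonoid : submonoid T;
  subcu_axioms : cu_axioms (sub_pom subcu_submonoid);
  subcu_val : cu_morphism (\val : sub_pom subcu_submonoid -> S)
}.

(* A sub-[Cu]-semigroup as a [Cu]-semigroup in its own right. *)
Definition sub_cu (S : cuType) (T : set S) (hT : is_subcu T) : Type :=
  sub_pom (subcu_submonoid hT).

HB.instance Definition _ (S : cuType) (T : set S) (hT : is_subcu T) :=
  POM.on (sub_cu hT).
HB.instance Definition _ (S : cuType) (T : set S) (hT : is_subcu T) :=
  POM_isCu.Build (sub_cu hT) (subcu_axioms hT).

Definition subcu_with (P : cuType -> Prop) (S : cuType) : set (set S) :=
  [set T | exists hT : is_subcu T, P (sub_cu hT)].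

Definition Sub_ctbl (S : cuType) : set (set S) :=
  [set T | exists hT : is_subcu T, countably_based (sub_cu hT)].

Definition sigma_complete (S : cuType) (R : set (set S)) :=
  forall C, C `<=` R -> countable C -> directed C ->
  R (sup_closure (\bigcup_(T in C) T)).

Definition cofinal (S : cuType) (R : set (set S)) :=
  forall T0, Sub_ctbl T0 -> exists2 T, R T & T0 `<=` T.

Definition lowenheim_skolem (P : cuType -> Prop) :=
  forall S : cuType, P S -> exists R : set (set S),
  [/\ R `<=` @Sub_ctbl S, sigma_complete R, cofinal R
    & R `<=` @subcu_with P S].

Definition dim_le (n : nat) (S : cuType) :=
  forall (r : nat) (x' x : S) (y : 'I_r -> S),
  x' ≪ x -> x ≪ \sum_j y j ->
  exists z : 'I_r -> 'I_n.+1 -> S,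
  [/\ forall j k, z j k ≪ y j,
      x' ≪ \sum_j \sum_k z j k
    & forall k, \sum_j z j k ≪ x].

(* Main.v *)
Require Import Defs.
From mathcomp Require Import all_boot order ssralg.
From mathcomp Require Import boolp classical_sets functions cardinality.

Set Implicit Arguments.
Unset Strict Implicit.
Unset Printing Implicit Defensive.

Import Order.TTheory GRing.Theory.

Local Open Scope ring_scope.
Local Open Scope order_scope.
Local Open Scope classical_set_scope.

(** Everything is deduced from one way of producing sub-[Cu]-semigroups.  Call
a submonoid [B] of [S] self-approximating when every [x] in [B] is approximated
from below by [B]: each [x' ≪ x] has some [b] in [B] with [x' <= b ≪ x].  Then
the set [hull B] of all elements of [S] approximated in this way by [B] is the
sup-closure of [B] ([sup_closureE]), since a [≪]-increasing sequence of
elements of [B] with supremum [x] can be extracted for each [x] in [hull B]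
([hull_seq]).  It is a sub-[Cu]-semigroup ([sub_cuP]): suprema and the relation
[≪] computed in [hull B] and in [S] coincide.

The property of having dimension at most [n] speaks of [≪]-relations between
finitely many elements only, so it passes from [B] to [hull B]: elements
[x' ≪ x ≪ y_1 + ... + y_r] of [hull B] can be replaced by elements
[b' ≪ b ≪ c_1 + ... + c_r] of [B] with [x' <= b'], [b ≪ x] and [c_j ≪ y_j],
and any solution for the latter is one for the former ([hull_dim_le]).  In the
same way a countable set interpolating the relation [≪] of [B] yields a basis
of [hull B] ([hull_Sub_ctbl_dim_le]).

For sigma-completeness, [B] is the union of the directed family: finitely many
elements of it lie in a common member, which has dimension at most [n], and the
union of countable bases of the members is countable.  For cofinality, [B] is a
countable set containing a countable basis of the given [T0] and closed under
finite sums, under the terms of a chosen [≪]-increasing sequence approximating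
each element, and under chosen witnesses of [dim S <= n] for each finite tuple
of elements ([countable_closure]). *)

(** * Suprema and the way-below relation in a partial order *)

Section Posets.
Context {d : Order.disp_t} {S : porderType d}.
Implicit Types (x y s t : S) (z : nat -> S).

Lemma sup_ub z s n : is_sup z s -> z n <= s.
Proof. by case=> ub _; apply: ub; exists n. Qed.

Lemma sup_least z s t : is_sup z s -> (forall n, z n <= t) -> s <= t.
Proof. by case=> _ lub zt; apply: lub => _ [n _ <-]; exact: zt. Qed.

Lemma is_supI z s :
  (forall n, z n <= s) -> (forall t, (forall n, z n <= t) -> s <= t) ->
  is_sup z s.
Proof.
move=> ub lub; split=> [_ [n _ <-]|t zt]; first exact: ub.
by apply: lub => n; apply: zt; exists n.
Qed.

Lemma way_below_le x y : x ≪ y -> x <= y.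
Proof.
move=> xy; have [|||n //] := xy (fun=> y) y; first by move=> *; exact: lexx.
  by apply: is_supI => [n|t /(_ 0%N)//]; exact: lexx.
exact: lexx.
Qed.

Lemma le_way_below x y t : x <= y -> y ≪ t -> x ≪ t.
Proof.
move=> xy yt z s zi zs ts; have [n yn] := yt z s zi zs ts.
by exists n; exact: le_trans yn.
Qed.

Lemma way_below_le_trans x y t : x ≪ y -> y <= t -> x ≪ t.
Proof.
by move=> xy yt z s zi zs ts; apply: xy zs _ => //; exact: le_trans ts.
Qed.

Lemma way_below_trans x y t : x ≪ y -> y ≪ t -> x ≪ t.
Proof. by move=> xy /way_below_le; exact: way_below_le_trans. Qed.

Lemma way_below_increasing z : (forall n, z n ≪ z n.+1) -> increasing z.
Proof.
move=> zz; apply: homo_leq => [x|y x t|n]; [exact: lexx|exact: le_trans|].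
exact: way_below_le.
Qed.

Lemma way_below_sup z s x : (forall n, z n ≪ z n.+1) -> is_sup z s ->
  x ≪ s -> exists n, x <= z n.
Proof. by move=> zz zs /(_ z s); apply=> //; exact: way_below_increasing. Qed.

Lemma way_below_seq_sup z s n :
  (forall n, z n ≪ z n.+1) -> is_sup z s -> z n ≪ s.
Proof. by move=> zz zs; apply: way_below_le_trans (zz n) _; exact: sup_ub. Qed.

End Posets.

(** * Sets approximated by a subset *)

Section CuSemigroups.
Variable S : cuType.
Implicit Types (x y : S) (z : nat -> S) (B : set S).

Lemma interpolation x' x : x' ≪ x -> exists2 y, x' ≪ y & y ≪ x.
Proof.
move=> x'x; have [z zz zx] := cu_O2 (@cuP S) x.
have [n x'n] := way_below_sup zz zx x'x; exists (z n.+1).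
  exact: le_way_below (zz n).
exact: way_below_seq_sup.
Qed.

Lemma pom_leD (x y x' y' : S) : x <= x' -> y <= y' -> x + y <= x' + y'.
Proof.
move=> xx yy; apply: le_trans (pom_leD2r _ _ _ xx) _.
by rewrite ![x' + _]addrC; exact: pom_leD2r.
Qed.

Lemma is_sup_sum (I : Type) (r : seq I) (f : I -> nat -> S) (g : I -> S) :
  (forall i, increasing (f i)) -> (forall i, is_sup (f i) (g i)) ->
  is_sup (fun m => \sum_(i <- r) f i m) (\sum_(i <- r) g i).
Proof.
move=> finc fg.
suff [] : increasing (fun m => \sum_(i <- r) f i m) /\
  is_sup (fun m => \sum_(i <- r) f i m) (\sum_(i <- r) g i) by [].
elim: r => [|i r [rinc rsup]].
  rewrite big_nil; under eq_fun do rewrite big_nil.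
  split=> [m p _|]; first exact: lexx.
  by apply: is_supI => [m|t /(_ 0%N)//]; exact: lexx.
rewrite big_cons; under eq_fun do rewrite big_cons.
split=> [m p mp|]; first by apply: pom_leD; [exact: finc | exact: rinc].
exact: cu_O4 (@cuP S) _ _ _ _ _ _ _ _.
Qed.

(** When [B] is contained in [hull B], this is the sup-closure of [B].  This
form makes closure under suprema immediate, whereas with suprema of sequences
in [B] it would need a diagonal argument. *)
Definition hull B : set S :=
  [set x | forall x', x' ≪ x -> exists2 b, B b & x' <= b /\ b ≪ x].

Lemma hull_sup_closed B : sup_closed (hull B).
Proof.
move=> z s zinc zB zs x' /interpolation[x x'x xs].
have [n xn] := xs z s zinc zs (lexx _).
have [b Bb [x'b bz]] := zB n x' (way_below_le_trans x'x xn).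
by exists b => //; split=> //; apply: way_below_le_trans bz _; exact: sup_ub.
Qed.

(** Start from a [≪]-increasing sequence [z] with supremum [x].  Between [z m]
and a later term of [z] there is always an element of [B], so that jumping from
index to index interleaves [z] with a sequence in [B]. *)
Lemma hull_seq B x : hull B x ->
  exists b, [/\ forall n, B (b n), forall n, b n ≪ b n.+1 & is_sup b x].
Proof.
move=> Bx; have [z zz zx] := cu_O2 (@cuP S) x.
have step m : exists p : S * nat,
    [/\ B p.1, z m ≪ p.1, p.1 <= z p.2 & (m < p.2)%N].
  have [b Bb [zb bx]] := Bx _ (way_below_seq_sup m.+1 zz zx).
  have [k bk] := way_below_sup zz zx bx.
  (* the maximum forces the indices to increase strictly, hence to be cofinal *)
  exists (b, maxn k m.+1); split=> //=; last by rewrite leq_maxr.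
    exact: way_below_le_trans (zz m) zb.
  apply: le_trans bk _; apply: (way_below_increasing zz); exact: leq_maxl.
have {step}[h hP] := choice step.
pose m := fix m n := if n is n'.+1 then (h (m n')).2 else 0%N.
exists (fun n => (h (m n)).1); split=> [n|n|]; first by case: (hP (m n)).
  have [_ _ le_b _] := hP (m n); have [_ wb _ _] := hP (m n.+1).
  exact: le_way_below le_b wb.
apply: is_supI => [n|t bt].
  have [_ _ le_b _] := hP (m n); apply: le_trans le_b _; exact: sup_ub.
apply: (sup_least zx) => n; have nm : (n <= m n)%N.
  elim: n => //= n IHn; have [_ _ _] := hP (m n); exact: leq_ltn_trans.
apply: le_trans (bt n); apply: le_trans (way_below_increasing zz nm) _.
by have [_ /way_below_le] := hP (m n).
Qed.

Lemma sup_closureE B : B `<=` hull B -> sup_closure B = hull B.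
Proof.
move=> BB; apply/seteqP; split.
  by apply: smallest_sub => //; exact: hull_sup_closed.
move=> x /hull_seq[b [Bb bb bx]] A [Acl BA].
by apply: Acl bx => [|n]; [exact: way_below_increasing | exact/BA].
Qed.

Definition interpolates (D B : set S) :=
  forall x' x, B x' -> B x -> x' ≪ x -> exists2 y, D y & x' <= y /\ y <= x.

(** Dimension at most [n] for [B], with [≪] and sums taken in the ambient
semigroup, so that it makes sense for subsets which are not closed under
suprema. *)
Definition dim_le_on n B := forall r (x' x : S) (y : 'I_r -> S),
  B x' -> B x -> (forall j, B (y j)) -> x' ≪ x -> x ≪ \sum_j y j ->
  exists z : 'I_r -> 'I_n.+1 -> S,
  [/\ forall j k, B (z j k), forall j k, z j k ≪ y j,
      x' ≪ \sum_j \sum_k z j k & forall k, \sum_j z j k ≪ x].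

(** Approximating the summands [y j] simultaneously by terms [c j p] uses (O4);
the inequalities between elements of [B] are then solved in [B]. *)
Lemma hull_dim_le n B : B `<=` hull B -> dim_le_on n B -> dim_le_on n (hull B).
Proof.
move=> BB dimB r x' x y hx' hx hy x'x xy.
have [b [Bb bb bx]] := hull_seq hx.
have [c cP] := choice (fun j => hull_seq (hy j)).
have cinc j : increasing (c j).
  by apply: way_below_increasing => n0; case: (cP j).
have [m bm] := way_below_sup bb bx x'x.
have [|p xp] := xy _ _ _ (is_sup_sum (index_enum _) cinc
  (fun j => let: And3 _ _ h := cP j in h)) (lexx _).
  move=> i j ij; elim/big_ind2 : _ => [|*|k _]; first exact: lexx.
    exact: pom_leD.
  exact: cinc.
have bxs k : b k ≪ x by exact: way_below_seq_sup.
have [||j|||z [Bz zc x'z zx]] := dimB r (b m.+1) (b m.+2) (fun j => c j p).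
- exact: Bb.
- exact: Bb.
- by case: (cP j).
- exact: bb.
- exact: way_below_le_trans (bxs _) xp.
exists z; split=> [j k|j k||k].
- exact/BB.
- have [_ cc cy] := cP j.
  exact: way_below_trans (zc j k) (way_below_seq_sup p cc cy).
- by apply: le_way_below x'z; apply: le_trans bm (way_below_le (bb _)).
- exact: way_below_trans (zx k) (bxs _).
Qed.

(** An element way below [x + y] is, by (O4), below the sum of two terms of
sequences in [B] approximating [x] and [y]; (O3) makes this sum way below
[x + y]. *)
Lemma hull_submonoid B : submonoid B -> submonoid (hull B).
Proof.
move=> [B0 BD]; split.
  rewrite inE => x' x'0; exists 0; first by rewrite -inE.
  by split=> [|z s _ _ _]; [exact: way_below_le | exists 0%N; exact: pom_ge0].
move=> x y; rewrite !inE => Bx By w' w'xy.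
have [b [Bb bb bx]] := hull_seq Bx; have [c [Bc cc cy]] := hull_seq By.
have binc := way_below_increasing bb; have cinc := way_below_increasing cc.
have [m p mp|m w'm] := w'xy _ _ _ (cu_O4 (@cuP S) binc cinc bx cy) (lexx _).
  by apply: pom_leD; [exact: binc | exact: cinc].
exists (b m + c m).
  by rewrite -inE; apply: BD; rewrite inE.
by split=> //; apply: (cu_O3 (@cuP S)); exact: way_below_seq_sup.
Qed.

Lemma hullS B D : B `<=` D -> hull B `<=` hull D.
Proof. by move=> BD x Bx x' /Bx[b /BD Db bP]; exists b. Qed.

End CuSemigroups.

(** * Sub-Cu-semigroups *)

Lemma sub_leE (S : pomType) (T : set S) (hT : submonoid T) (x y : sub_pom hT) :
  (x <= y) = (\val x <= \val y).
Proof. by rewrite Order.le_val. Qed.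

Section SubCu.
Variables (S : cuType) (T : set S).

Section Criterion.
Hypotheses (hT : submonoid T) (Tsup : sup_closed T) (TT : T `<=` hull T).
Local Notation sub := (sub_pom hT).
Implicit Types (x y s : sub) (z : nat -> sub).

(* By (O1), [z] has a supremum in [S]; as [T] is sup-closed it lies in [T], so
   it is also the supremum in [T]. *)
Let sub_sup z s : increasing z ->
  is_sup z s <-> is_sup (fun n => \val (z n)) (\val s).
Proof.
move=> zinc; split=> zs; last first.
  apply: is_supI => [n|t zt]; rewrite sub_leE; first exact: (sup_ub n zs).
  by apply: (sup_least zs) => n; rewrite -sub_leE.
have vinc : increasing (fun n => \val (z n)).
  by move=> i j ij; rewrite -sub_leE; exact: zinc.
have [t zt] := cu_O1 (@cuP S) vinc.
have Tt : t \in T.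
  by apply/mem_set/(Tsup vinc _ zt) => n; apply/set_mem/(valP (z n)).
suff -> : \val s = t by [].
apply/eqP; rewrite eq_le; apply/andP; split; last first.
  by apply: (sup_least zt) => n; rewrite -sub_leE; exact: sup_ub.
rewrite -[t](SubK sub Tt) -sub_leE; apply: (sup_least zs) => n.
by rewrite sub_leE SubK; exact: (sup_ub n zt).
Qed.

Let sub_seq x : exists z,
  (forall n, \val (z n) ≪ \val (z n.+1)) /\ is_sup z x.
Proof.
have [b [Tb bb bx]] := hull_seq (TT (set_mem (valP x))).
exists (fun n => Sub (b n) (mem_set (Tb n))).
split=> [n|]; first by rewrite !SubK.
apply/sub_sup => [m n mn|]; last first.
  by under eq_fun do rewrite SubK; rewrite /=.
by rewrite sub_leE !SubK; exact: way_below_increasing mn.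
Qed.

(* If [x ≪ y] in [T], then [x] is below a term of a sequence in [T] which is
   [≪]-increasing in [S] and has supremum [y]. *)
Let sub_way_below x y : x ≪ y <-> \val x ≪ \val y.
Proof.
split=> [xy|xy z s zinc zs ys]; last first.
  have [|||n xn] := xy (fun n => \val (z n)) (\val s).
  - by move=> m p mp; rewrite -sub_leE; exact: zinc.
  - exact/sub_sup.
  - by rewrite -sub_leE.
  - by exists n; rewrite sub_leE.
have [z [zz zy]] := sub_seq y.
have zinc : increasing z.
  move=> m p mp; rewrite sub_leE.
  exact: (way_below_increasing (z := fun n => \val (z n))).
have [n xn] := xy z y zinc zy (lexx _).
apply: (@le_way_below _ _ _ (\val (z n))); first by rewrite -sub_leE.
by apply: way_below_le_trans (zz n) _; rewrite -sub_leE; exact: sup_ub.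
Qed.

(** Sup-closedness makes suprema agree in [T] and in [S], self-approximation
makes [≪] agree; the axioms are then inherited from [S]. *)
Lemma sub_cuP : is_subcu T.
Proof.
exists hT; split.
- move=> z zinc; have vinc : increasing (fun n => \val (z n)).
    by move=> i j ij; rewrite -sub_leE; exact: zinc.
  have [t zt] := cu_O1 (@cuP S) vinc.
  have Tt : t \in T.
    by apply/mem_set/(Tsup vinc _ zt) => n; apply/set_mem/(valP (z n)).
  by exists (Sub t Tt); apply/sub_sup => //; rewrite SubK.
- move=> x; have [z [zz zx]] := sub_seq x.
  by exists z => // n; apply/sub_way_below.
- move=> x' x y' y /sub_way_below xx /sub_way_below yy.
  by apply/sub_way_below; rewrite !GRing.valD; exact: cu_O3 (@cuP S) _ _ _ _ _ _.
- move=> z w s t zinc winc /(sub_sup _ zinc) zs /(sub_sup _ winc) wt.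
  apply/sub_sup => [m n mn|].
    rewrite sub_leE !GRing.valD; apply: pom_leD.
      by rewrite -sub_leE; exact: zinc.
    by rewrite -sub_leE; exact: winc.
  rewrite GRing.valD; under eq_fun do rewrite GRing.valD.
  exact: cu_O4 (@cuP S) _ _ _ _ zinc winc zs wt.
- by move=> x y; rewrite -sub_leE.
- by split=> [|x y]; rewrite ?GRing.val0 ?GRing.valD.
- by move=> z s zinc /(sub_sup _ zinc).
- by move=> x y /sub_way_below.
Qed.

End Criterion.

Variable hT : is_subcu T.
Local Notation sub := (sub_cu hT).

(** One direction is part of the definition of a [Cu]-morphism; the other holds
because the inclusion preserves suprema and reflects the order. *)
Lemma subcu_way_below (x y : sub) : x ≪ y <-> \val x ≪ \val y.
Proof.
split=> [|xy z s zinc zs ys]; first exact: cu_morph_way_below (subcu_val hT) _ _.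
have [|||n xn] := xy (fun n => \val (z n)) (\val s).
- by move=> m p mp; rewrite -sub_leE; exact: zinc.
- exact: (cu_morph_sup (subcu_val hT)).
- by rewrite -sub_leE.
- by exists n; rewrite sub_leE.
Qed.

(** With [D := T] this says that [T] is self-approximating; with [D] a countable
basis, that [T] is recovered from countably many elements. *)
Lemma subcu_hull (D : set S) : interpolates D T -> T `<=` hull D.
Proof.
move=> TD x Tx x' x'x.
have [z zz zx] := cu_O2 (@cuP sub) (Sub x (mem_set Tx)).
have vzz n : \val (z n) ≪ \val (z n.+1) by apply/subcu_way_below.
have vzx : is_sup (fun n => \val (z n)) x.
  by have := cu_morph_sup (subcu_val hT) (way_below_increasing zz) zx.
have [n x'n] := way_below_sup vzz vzx x'x.
have [||y Dy [ny yn]] := TD _ _ _ _ (vzz n); try exact: set_mem (valP _).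
exists y => //; split; first exact: le_trans ny.
by apply: le_way_below yn (way_below_seq_sup _ vzz vzx).
Qed.

(** This reduces statements about the semigroup [T] to statements in [S]. *)
Lemma subcu_dim_le n : dim_le n sub <-> dim_le_on n T.
Proof.
have val_sum (I : Type) (r : seq I) (f : I -> sub) :
    \val (\sum_(i <- r) f i) = \sum_(i <- r) \val (f i).
  by elim/big_rec2 : _ => [|i y1 y2 _ <-]; rewrite ?GRing.val0 ?GRing.valD.
split=> dimT r x' x y.
  move=> Tx' Tx Ty x'x xy.
  have [|| z [zy x'z zx]] := dimT r (Sub x' (mem_set Tx')) (Sub x (mem_set Tx))
    (fun j => Sub (y j) (mem_set (Ty j))).
  - by apply/subcu_way_below; rewrite !SubK.
  - by apply/subcu_way_below; rewrite val_sum; under eq_bigr do rewrite SubK.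
  exists (fun j k => \val (z j k)); split=> [j k|j k||k].
  - exact: set_mem (valP _).
  - by have /subcu_way_below := zy j k; rewrite SubK.
  - move/subcu_way_below : x'z; rewrite val_sum SubK.
    by under eq_bigr do rewrite val_sum.
  - by have /subcu_way_below := zx k; rewrite val_sum SubK.
move=> /subcu_way_below x'x /subcu_way_below; rewrite val_sum => xy.
have Tv x0 : T (\val (x0 : sub)) by exact: set_mem (valP _).
have [z [Tz zy x'z zx]] := dimT r _ _ _ (Tv _) (Tv _) (fun j => Tv (y j)) x'x xy.
exists (fun j k => Sub (z j k) (mem_set (Tz j k))); split=> [j k||k];
  apply/subcu_way_below; rewrite ?val_sum.
- by rewrite SubK.
- by under eq_bigr do (rewrite val_sum; under eq_bigr do rewrite SubK).
- by under eq_bigr do rewrite SubK; exact: zx.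
Qed.

Lemma subcu_countably_based : countably_based sub <->
  exists D, [/\ countable D, D `<=` T & forall x' x, T x' -> T x -> x' ≪ x ->
    exists y, [/\ D y, x' ≪ y & y ≪ x]].
Proof.
split=> [[B cB basB]|[D [cD DT Dbas]]].
  exists (\val @` B); split.
  - by apply: sub_countable cB; exact: card_image_le.
  - by move=> _ [x _ <-]; exact: set_mem (valP _).
  - move=> x' x Tx' Tx x'x.
    have [|y [By]] := basB (Sub x' (mem_set Tx')) (Sub x (mem_set Tx)).
      by apply/subcu_way_below; rewrite !SubK.
    by move=> /subcu_way_below + /subcu_way_below; rewrite !SubK; exists (\val y).
exists (\val @^-1` D).
  rewrite -(eq_countable (inj_card_eq (f := \val) _)).
    by apply: sub_countable cD; apply: subset_card_le => _ [x Dx <-].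
  by move=> x y _ _; exact: val_inj.
move=> x' x /subcu_way_below x'x.
have [||y [Dy x'y yx]] := Dbas _ _ _ _ x'x; try exact: set_mem (valP _).
exists (Sub y (mem_set (DT y Dy))).
by split; rewrite /= ?SubK//; apply/subcu_way_below; rewrite SubK.
Qed.

End SubCu.

(** * Producing countably based sub-Cu-semigroups of bounded dimension *)

(** The basis [D] is kept apart from [B] because a directed union of
sub-[Cu]-semigroups is uncountable in general, although it has a countable
interpolating subset. *)
Lemma hull_Sub_ctbl_dim_le (S : cuType) n (B D : set S) :
  submonoid B -> B `<=` hull B -> dim_le_on n B ->
  countable D -> D `<=` hull B ->
  interpolates D B ->
  (@Sub_ctbl S `&` @subcu_with (dim_le n) S) (hull B).
Proof.
move=> Bmon BB dimB cD DB Dbas.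
have hB : is_subcu (hull B).
  apply: sub_cuP; [exact: hull_submonoid|exact: hull_sup_closed|exact: hullS].
split; exists hB; last exact/subcu_dim_le/hull_dim_le.
apply/subcu_countably_based; exists D; split=> // x' x _ Bx x'x.
have [b [Bb bb bx]] := hull_seq Bx.
have [m x'm] := way_below_sup bb bx x'x.
have [y Dy [by1 yb]] := Dbas _ _ (Bb m.+1) (Bb m.+2) (bb _).
exists y; split=> //.
  exact: le_way_below x'm (way_below_le_trans (bb m) by1).
exact: le_way_below yb (way_below_seq_sup _ bb bx).
Qed.

(** * Directed unions *)

Lemma directed_seq (S : porderType cu_display) (C : set (set S)) (s : seq S) :
  directed C -> (forall x, x \in s -> (\bigcup_(T in C) T) x) ->
  exists2 T, C T & forall x, x \in s -> T x.
Proof.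
move=> [[T0 CT0] Cdir]; elim: s => [|x s IHs] sC; first by exists T0.
have [y ys|T CT sT] := IHs; first by apply: sC; rewrite inE ys orbT.
have [T1 CT1 T1x] := sC x (mem_head _ _).
have [T2 CT2 [TT2 T1T2]] := Cdir _ _ CT CT1.
exists T2 => // y; rewrite inE => /predU1P[->|/sT]; [exact: T1T2 | exact: TT2].
Qed.

Lemma dim_le_sigma_complete n (S : cuType) :
  sigma_complete (@Sub_ctbl S `&` @subcu_with (dim_le n) S).
Proof.
move=> C CR cC Cdir; set B := \bigcup_(T in C) T.
have TB T : C T -> T `<=` B by move=> CT x Tx; exists T.
have BB : B `<=` hull B.
  move=> x [T CT Tx]; have [[hT _] _] := CR _ CT.
  apply: (hullS (TB T CT)); apply: (subcu_hull hT) Tx => y' y Ty' _ /way_below_le.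
  by exists y' => //; split=> //; exact: lexx.
rewrite sup_closureE //.
have /choice[D DP] : forall T, exists D : set S, C T -> [/\ countable D, D `<=` T &
    forall x' x, T x' -> T x -> x' ≪ x -> exists y, [/\ D y, x' ≪ y & y ≪ x]].
  move=> T; have [CT|nCT] := pselect (C T); last by exists set0.
  by have [[hT /subcu_countably_based[D DP]] _] := CR _ CT; exists D.
apply: (@hull_Sub_ctbl_dim_le _ _ _ (\bigcup_(T in C) D T)) => //.
- have [[T0 CT0] _] := Cdir; split.
    rewrite inE; exists T0 => //; have [[[[T00 _] _ _] _] _] := CR _ CT0.
    exact: set_mem.
  move=> x y /set_mem Bx /set_mem By; apply/mem_set.
  have [z|T CT Txy] := directed_seq (s := [:: x; y]) Cdir.
    by rewrite !inE => /orP[]/eqP->.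
  exists T => //; have [[[[_ TD] _ _] _] _] := CR _ CT.
  by apply/set_mem/TD; apply/mem_set/Txy; rewrite !inE eqxx ?orbT.
- move=> r x' x y Bx' Bx By x'x xy.
  have [z|T CT Tall] := directed_seq (s := x' :: x :: codom y) Cdir.
    by rewrite !inE => /orP[/eqP->|/orP[/eqP->|/codomP[j ->]]] //; exact: By.
  have [_ [hT /subcu_dim_le dimT]] := CR _ CT.
  have [||j|z [Tz zP]] := dimT r x' x y _ _ _ x'x xy.
  - by apply: Tall; rewrite !inE eqxx.
  - by apply: Tall; rewrite !inE eqxx orbT.
  - by apply: Tall; rewrite !inE codom_f !orbT.
  by exists z; split=> // j k; exact: TB (Tz j k).
- by apply: bigcup_countable => // T /DP[].
- by move=> x [T CT DTx]; apply/BB/(TB T CT); have [_ + _] := DP _ CT; exact.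
move=> x' x Bx' Bx x'x.
have [z|T CT Tall] := directed_seq (s := [:: x'; x]) Cdir.
  by rewrite !inE => /orP[]/eqP->.
have [_ _ Dbas] := DP _ CT.
have [||y [Dy x'y yx]] := Dbas x' x _ _ x'x;
  try by apply: Tall; rewrite !inE eqxx ?orbT.
by exists y; [exists T | split; exact: way_below_le].
Qed.

(** * Countable closures *)

Lemma countable_sub_range (U : choiceType) (x0 : U) (A : set U) :
  countable A -> exists e : nat -> U, A `<=` range e.
Proof.
move=> /countable_injP[f finj].
exists (fun k => xget x0 [set x | A x /\ f x = k]) => x Ax; exists (f x) => //.
case: xgetP => [y _ [Ay fy]|/(_ x)/not_andP[]//].
by apply: finj => //; rewrite inE.
Qed.

Lemma countable_setU U (A B : set U) :
  countable A -> countable B -> countable (A `|` B).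
Proof.
move=> cA cB.
have -> : A `|` B = \bigcup_(b in [set: bool]) (if b then A else B).
  apply/seteqP; split=> [x [Ax|Bx]|x [[] _]]; [by exists true|by exists false| |];
  by [left|right].
by apply: bigcup_countable => // -[].
Qed.

(** The closure consists of the values of finitely branching terms: a leaf is
labelled by an index in an enumeration of [A], a node with arguments [l] by an
index in an enumeration of [W l].  There are countably many such terms. *)
Lemma countable_closure (U : choiceType) (x0 : U) (A : set U)
    (W : seq U -> set U) : countable A -> (forall l, countable (W l)) ->
  exists B, [/\ countable B, A `<=` B &
    forall l, (forall x, x \in l -> B x) -> W l `<=` B].
Proof.
move=> /(countable_sub_range x0)[a Aa] cW.
have /choice[w Ww] := fun l => countable_sub_range x0 (cW l).
pose eval := fix eval t := match t with
  | GenTree.Leaf k => a k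
  | GenTree.Node k ts => w [seq eval t | t <- ts] k end.
exists (range eval); split.
- by apply: sub_countable (countableP _); exact: card_image_le.
- by move=> x /Aa[k _ <-]; exists (GenTree.Leaf k).
move=> l lB x /Ww[k _ <-].
have [ts <-] : exists ts, map eval ts = l.
  elim: l lB => [|y l IHl] lB; first by exists [::].
  have [|ts tsl] := IHl; first by move=> z zl; apply: lB; rewrite inE zl orbT.
  by have [t _ ty] := lB y (mem_head _ _); exists (t :: ts); rewrite /= ty tsl.
by exists (GenTree.Node k ts).
Qed.

(** Witnesses are attached to sequences, the input format of
[countable_closure]; the sequence [l] determines [r], [x'], [x] and [y]. *)
Lemma dim_le_witnesses n (S : cuType) (l : seq S) : dim_le n S ->
  exists w : set S, countable w /\
  forall r (x' x : S) (y : 'I_r -> S), l = x' :: x :: codom y ->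
  x' ≪ x -> x ≪ \sum_j y j ->
  exists z : 'I_r -> 'I_n.+1 -> S,
  [/\ forall j k, w (z j k), forall j k, z j k ≪ y j,
      x' ≪ \sum_j \sum_k z j k & forall k, \sum_j z j k ≪ x].
Proof.
move=> dimS.
have [[r [x' [x [y [le x'x xy]]]]]|no] := pselect (exists r x' x (y : 'I_r -> S),
    [/\ l = x' :: x :: codom y, x' ≪ x & x ≪ \sum_j y j]); last first.
  exists set0; split=> // r x' x y le x'x xy.
  by case: no; exists r, x', x, y.
have [z [zy x'z zx]] := dimS r x' x y x'x xy.
exists (range (fun p => z p.1 p.2)); split.
  by apply: sub_countable (countableP _); exact: card_image_le.
move=> r1 x1' x1 y1; rewrite le => -[<- <- yy1] _ _.
have rr1 : r = r1 by have := congr1 size yy1; rewrite !size_codom !card_ord.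
case: r1 / rr1 y1 yy1 => y1 yy1.
have -> : y1 = y.
  apply/funext => j; move: yy1; rewrite !codomE => /eq_in_map.
  by move=> /(_ j (mem_enum _ j)).
by exists z; split=> // j k; exists (j, k).
Qed.

Lemma dim_le_cofinal n (S : cuType) : dim_le n S ->
  cofinal (@Sub_ctbl S `&` @subcu_with (dim_le n) S).
Proof.
move=> dimS T0 [hT0 /subcu_countably_based[D [cD _ Dbas]]].
have /choice[w wP] := fun l => dim_le_witnesses l dimS.
have /choice[a aP] : forall x : S, exists a : nat -> S,
    (forall m, a m ≪ a m.+1) /\ is_sup a x.
  by move=> x; have [a aa ax] := cu_O2 (@cuP S) x; exists a.
(* The sums over [[::]] and [[:: x; y]] give closure under zero and addition;
   the value at [[:: x]] contains the sequence approximating [x]. *)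
pose W l := [set \sum_(x <- l) x] `|` (range (a (head 0 l)) `|` w l).
have [l|B [cB DB WB]] := countable_closure 0 (W := W) cD.
  apply: countable_setU; first exact: countable1.
  apply: countable_setU (wP l).1.
  by apply: sub_countable (countableP _); exact: card_image_le.
have BB : B `<=` hull B.
  move=> x Bx x' x'x; have [aa ax] := aP x.
  have [m x'm] := way_below_sup aa ax x'x.
  exists (a x m); last by split=> //; exact: way_below_seq_sup aa ax.
  apply: (WB [:: x]); first by move=> y; rewrite inE => /eqP->.
  by right; left; exists m.
exists (hull B); last first.
  apply: subset_trans (hullS DB); apply: (subcu_hull hT0) => x' x Tx' Tx x'x.
  have [y [Dy x'y yx]] := Dbas _ _ Tx' Tx x'x.
  by exists y => //; split; exact: way_below_le.
apply: (@hull_Sub_ctbl_dim_le _ _ _ B) => //.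
- split=> [|x y /set_mem Bx /set_mem By]; apply/mem_set.
    by apply: (WB [::]) => //; left; rewrite big_nil.
  apply: (WB [:: x; y]); first by move=> z; rewrite !inE => /orP[]/eqP->.
  by left; rewrite !big_cons big_nil addr0.
- move=> r x' x y Bx' Bx By x'x xy.
  have [z [wz zP]] := (wP _).2 r x' x y erefl x'x xy.
  exists z; split=> // j k; apply: (WB (x' :: x :: codom y)).
    by move=> t; rewrite !inE => /orP[/eqP->|/orP[/eqP->|/codomP[i ->]]].
  by right; right; exact: wz.
- by move=> x' x Bx' _ /way_below_le; exists x' => //; split=> //; exact: lexx.
Qed.

Theorem proposition5p6 (n : nat) :
  (forall S : cuType, dim_le n S ->
     let R := @Sub_ctbl S `&` @subcu_with (dim_le n) S in
     sigma_complete R /\ cofinal R) /\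
  lowenheim_skolem (dim_le n).
Proof.
have main (S : cuType) : dim_le n S ->
    sigma_complete (@Sub_ctbl S `&` @subcu_with (dim_le n) S) /\
    cofinal (@Sub_ctbl S `&` @subcu_with (dim_le n) S).
  by move=> dimS; split; [exact: dim_le_sigma_complete | exact: dim_le_cofinal].
split=> // S /main[Rsig Rcof].
by exists (@Sub_ctbl S `&` @subcu_with (dim_le n) S); split=> // T [].
Qed.
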